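(* Let $n\geq 1$ and let $a_1,\ldots,a_n$ be a monotonic (increasing or decreasing) sequence of $n$ distinct real numbers. Then there is a permutation $b_1,\ldots,b_n$ of $a_1,\ldots,a_n$ with $b_1=a_1$ such that the $n-1$ numbers $$|b_1-b_2|,\ |b_2-b_3|,\ \ldots,\ |b_{n-1}-b_n|$$ are pairwise distinct. *)

(* Defs.v *)
From mathcomp Require Export all_boot all_order all_algebra.
From mathcomp Require Export reals.

(* Main.v *)
Require Import Defs.
From mathcomp Require Import all_boot all_order all_algebra.
From mathcomp Require Import reals.
Set Implicit Arguments.
Unset Strict Implicit.
Unset Printing Implicit Defensive.
Import Order.TTheory GRing.Theory Num.Theory.
Local Open Scope ring_scope.

(** The zigzag a_1, a_n, a_2, a_(n-1), ... works: the intervals spanned by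
    consecutive terms are strictly nested, so the gaps strictly decrease.
    Its tail is the zigzag of the reversal of a_2, ..., a_n, and reversal
    preserves monotonicity up to its direction. *)

Lemma rev_tail_ind (T : Type) (P : seq T -> Prop) :
    P [::] -> (forall x s, P (rev s) -> P (x :: s)) -> forall s, P s.
Proof.
move=> P_nil P_cons s; have [n] := ubnP (size s).
elim: n s => // n IHn [//|x s] /= size_s.
by apply/P_cons/IHn; rewrite size_rev.
Qed.

Section Zigzag.
Variable T : Type.
Implicit Types (x : T) (s : seq T).

Fixpoint zigzag_rec (n : nat) (s : seq T) : seq T :=
  match n, s with
  | n'.+1, x :: s' => x :: zigzag_rec n' (rev s')
  | _, _ => [::]
  end.

Definition zigzag (s : seq T) : seq T := zigzag_rec (size s) s.

Lemma zigzag_cons x s : zigzag (x :: s) = x :: zigzag (rev s).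
Proof. by rewrite /zigzag size_rev. Qed.

Lemma head_zigzag x s : head x (zigzag s) = head x s.
Proof. by case: s. Qed.

End Zigzag.

Lemma perm_zigzag (T : eqType) (s : seq T) : perm_eq (zigzag s) s.
Proof.
elim/rev_tail_ind: s => // x s perm_rev_s.
by rewrite zigzag_cons perm_cons (perm_trans perm_rev_s) ?perm_rev.
Qed.

Lemma sorted_between (T : eqType) (r : rel T) (x y z : T) (s : seq T) :
    transitive r -> sorted r (x :: rcons s y) -> z \in s -> r x z && r z y.
Proof.
move=> r_trans; rewrite (sorted_pairwise r_trans) /= all_rcons pairwise_rcons.
by case/and3P=> /andP[_ /allP r_x] /allP r_y _ z_in; rewrite r_x ?r_y.
Qed.

Section StrictlyMonotone.
Variables (disp : Order.disp_t) (T : porderType disp).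
Implicit Types (x y z : T) (s : seq T).

Lemma gt_sorted_uniq_ge s : sorted >%O s = uniq s && sorted >=%O s.
Proof. by rewrite -(rev_sorted <%O) lt_sorted_uniq_le rev_uniq rev_sorted. Qed.

Definition strictly_monotone (s : seq T) : bool :=
  sorted <%O s || sorted >%O s.

Lemma uniq_strictly_monotone s :
  uniq s -> strictly_monotone s = sorted <=%O s || sorted >=%O s.
Proof.
by rewrite /strictly_monotone lt_sorted_uniq_le gt_sorted_uniq_ge => ->.
Qed.

Lemma strictly_monotone_rev s :
  strictly_monotone (rev s) = strictly_monotone s.
Proof. by rewrite /strictly_monotone !rev_sorted orbC. Qed.

Lemma strictly_monotone_behead x s :
  strictly_monotone (x :: s) -> strictly_monotone s.
Proof. by case/orP=> /path_sorted s_sorted; apply/orP; [left | right]. Qed.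

Lemma strictly_monotone_between x y z s :
    strictly_monotone (x :: rcons s y) -> z \in s ->
  (x < z < y)%O || (y < z < x)%O.
Proof.
case/orP=> s_sorted z_in; apply/orP; [left | right].
  exact: sorted_between lt_trans s_sorted z_in.
by rewrite andbC; exact: sorted_between (rev_trans lt_trans) s_sorted z_in.
Qed.

End StrictlyMonotone.

Definition gaps (R : numDomainType) (V : normedZmodType R) (s : seq V) :
  seq R := pairmap (fun x y => `|x - y|) (head 0 s) (behead s).

Lemma gaps_nth (R : numDomainType) (V : normedZmodType R) (s : seq V) :
  gaps s = [seq `|s`_i - s`_i.+1| | i <- iota 0 (size s).-1].
Proof.
case: s => // x s; apply: (@eq_from_nth _ 0).
  by rewrite size_pairmap size_map size_iota.
move=> i; rewrite size_pairmap => i_lt.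
by rewrite (nth_pairmap 0) // (nth_map 0) ?size_iota // nth_iota.
Qed.

Lemma ltr_dist_between (R : numDomainType) (x y z : R) :
  (x < z < y) || (y < z < x) -> `|y - z| < `|x - y|.
Proof.
case/orP=> /andP[].
  move=> lt_xz lt_zy; have lt_xy := lt_trans lt_xz lt_zy.
  by rewrite (distrC x) !gtr0_norm ?subr_gt0 // ltrD2l ltrN2.
move=> lt_yz lt_zx; have lt_yx := lt_trans lt_yz lt_zx.
by rewrite distrC !gtr0_norm ?subr_gt0 // ltrD2r.
Qed.

Lemma sorted_gaps_zigzag (R : numDomainType) (s : seq R) :
  strictly_monotone s -> sorted >%R (gaps (zigzag s)).
Proof.
elim/rev_tail_ind: s => // x s; case/lastP: s => // s y IHs s_mono.
have zigzag_rev : zigzag (rev (rcons s y)) = y :: zigzag s.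
  by rewrite rev_rcons zigzag_cons revK.
have gaps_zigzag_rev : sorted >%R (gaps (y :: zigzag s)).
  rewrite -zigzag_rev; apply: IHs; rewrite strictly_monotone_rev.
  exact: strictly_monotone_behead s_mono.
rewrite zigzag_cons zigzag_rev.
have := perm_mem (perm_zigzag s).
case: (zigzag s) gaps_zigzag_rev => // z t gaps_sorted mem_zigzag.
have z_in : z \in s by rewrite -mem_zigzag mem_head.
apply/andP; split; last exact: gaps_sorted.
exact/ltr_dist_between/(strictly_monotone_between s_mono z_in).
Qed.

Theorem theorem1p1 (R : realType) (n : nat) (hn : (1 <= n)%N)
    (a : n.-tuple R) (a_distinct : uniq a)
    (a_monotonic : sorted <=%R a \/ sorted >=%R a) :
  exists b : n.-tuple R,
    [/\ perm_eq b a,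
        b`_0 = a`_0 &
        uniq [seq `|b`_i - b`_i.+1| | i <- iota 0 n.-1]].
Proof.
have size_zigzag : size (zigzag a) == n.
  by rewrite (perm_size (perm_zigzag a)) size_tuple.
exists (Tuple size_zigzag); split=> /=.
- exact: perm_zigzag.
- by rewrite !nth0 head_zigzag.
have -> : n.-1 = (size (zigzag a)).-1 by rewrite (eqP size_zigzag).
rewrite -gaps_nth; apply: (sorted_uniq (rev_trans lt_trans) ltxx).
by apply: sorted_gaps_zigzag; rewrite uniq_strictly_monotone //; apply/orP.
Qed.
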